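(* Let $d$ be a graphical degree function on a finite set $V$ with $|V|=n$ and let $v\in V$. Identify subsets of $V\setminus\{v\}$ with subsets of $[n-1]$ by ordering $V\setminus\{v\}$ as $u_1\succ u_2\succ\dots\succ u_{n-1}$ by non-increasing degree, ties broken by label, and letting $u_i$ correspond to $i$. Then the family $I_v$ of realizable neighborhoods of $v$ is a shifted family of $d(v)$-subsets of $[n-1]$.
   Context: All graphs are finite and simple. A degree function on a finite set $V$ with $|V|=n$ is a map $d:V\to\{0,1,\dots,n-1\}$; it is graphical if some simple graph on $V$ has $\deg(u)=d(u)$ for all $u$; such a labeled graph is a realization of $d$. Labels: $V$ carries a fixed linear order used to break ties. A set $S\subseteq V\setminus\{v\}$ is a realizable neighborhood of $v$ if some realization $G$ of $d$ has $N_G(v)=S$; $I_v$ is the set of all realizable neighborhoods of $v$. A family $F$ of $k$-subsets of $[m]=\{1,\dots,m\}$ is shifted if it is nonempty and whenever $X\in F$, $j\in X$, $i<j$, $i\notin X$, also $(X\setminus\{j\})\cup\{i\}\in F$. *)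

(* Defs.v *)
From HB Require Import structures.
From mathcomp Require Import all_boot all_order.
Set Implicit Arguments.
Unset Strict Implicit.
Unset Printing Implicit Defensive.

(* A graph on the vertex type V is given by its set of edges, an edge being a
   2-element set of vertices. *)
Definition simple_graph (V : finType) (E : {set {set V}}) : bool :=
  [forall e in E, #|e| == 2].

(* [set u; u] has cardinality 1, so in a simple graph u is not in N(u). *)
Definition neighborhood (V : finType) (E : {set {set V}}) (u : V) : {set V} :=
  [set w | [set u; w] \in E].

Definition deg (V : finType) (E : {set {set V}}) (u : V) : nat :=
  #|neighborhood E u|.

Definition realization (V : finType) (n : nat) (d : V -> 'I_n)
    (E : {set {set V}}) : bool :=
  simple_graph E && [forall u, deg E u == d u].

Definition graphical (V : finType) (n : nat) (d : V -> 'I_n) : Prop :=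
  exists E : {set {set V}}, realization d E.

Definition realizable_neighborhoods (V : finType) (n : nat) (d : V -> 'I_n)
    (v : V) : {set {set V}} :=
  [set S : {set V} | (S \subset [set~ v]) &&
     [exists E : {set {set V}}, realization d E && (neighborhood E v == S)]].

(* u comes before w: larger degree first, ties broken by smaller label. *)
Definition degree_order (disp : Order.disp_t) (V : finOrderType disp)
    (n : nat) (d : V -> 'I_n) : rel V :=
  fun u w => (d w < d u) || ((d u == d w) && (u <= w)%O).

Definition ordered_others (disp : Order.disp_t) (V : finOrderType disp)
    (n : nat) (d : V -> 'I_n) (v : V) : seq V :=
  sort (degree_order d) (enum [set~ v]).

(* The subset of [n-1] corresponding to S; positions are counted from 0, so
   that the vertex u_k of the 1-based enumeration is at position k - 1. When
   #|V| = n the sequence has length n.-1, and the default v of nth is unused. *)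
Definition index_set (disp : Order.disp_t) (V : finOrderType disp)
    (n : nat) (d : V -> 'I_n) (v : V) (S : {set V}) : {set 'I_n.-1} :=
  [set i : 'I_n.-1 | nth v (ordered_others d v) i \in S].

Definition uniform_family (m k : nat) (F : {set {set 'I_m}}) : Prop :=
  forall X : {set 'I_m}, X \in F -> #|X| = k.

Definition shifted (m : nat) (F : {set {set 'I_m}}) : Prop :=
  F != set0 /\
  forall (X : {set 'I_m}) (i j : 'I_m),
    X \in F -> j \in X -> i < j -> i \notin X -> i |: (X :\ j) \in F.

(* Main.v *)
Require Import Defs.
From mathcomp Require Import all_boot all_order.

Set Implicit Arguments.
Unset Strict Implicit.
Unset Printing Implicit Defensive.

(** The family is nonempty because a realization of [d] exists, and uniform
    because the neighborhood of [v] has [d v] elements in every realization.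

    Shiftedness is an edge-switching argument.  Let [b] be a neighbor of [v] in
    a realization and [a] a non-neighbor with [d b <= d a].  Leaving aside the
    possible edge between [a] and [b], the vertex [a] has at least as many
    neighbors as [b], while [v] is a neighbor of [b] but not of [a]; hence some
    [w] is a neighbor of [a] but not of [b] ([exists_private_neighbor]).  On the
    four vertices [v], [b], [a], [w], replacing the edges [vb], [aw] by the
    non-edges [va], [bw] preserves all degrees ([realization_switch]) and trades
    [b] for [a] in the neighborhood of [v].  Since positions enumerate the other
    vertices by non-increasing degree, every shift is such a trade
    ([index_set_exchange]). *)

Lemma eq_set2 (T : finType) (x y z t : T) :
  ([set x; y] == [set z; t]) = ((x == z) && (y == t)) || ((x == t) && (y == z)).
Proof.
apply/eqP/idP => [exy|]; last first.
  by case/orP=> /andP[/eqP-> /eqP->] //; rewrite setUC.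
have: x \in [set z; t] by rewrite -exy set21.
have: y \in [set z; t] by rewrite -exy set22.
have: z \in [set x; y] by rewrite exy set21.
have: t \in [set x; y] by rewrite exy set22.
rewrite !in_set2 (eq_sym z x) (eq_sym z y) (eq_sym t x) (eq_sym t y).
by case: (x == z); case: (y == t); case: (x == t); case: (y == z).
Qed.

Section Switching.

Variable V : finType.
Implicit Types (E : {set {set V}}) (a b v w x y : V).

Lemma neighborhood_sym E x y :
  (y \in neighborhood E x) = (x \in neighborhood E y).
Proof. by rewrite !inE setUC. Qed.

Lemma notin_neighborhood E x : simple_graph E -> x \notin neighborhood E x.
Proof.
move=> /forall_inP sE; rewrite inE setUid; apply/negP => /sE.
by rewrite cards1.
Qed.

Definition switch E v b a w : {set {set V}} :=
  [set v; a] |: ([set b; w] |: ((E :\ [set v; b]) :\ [set a; w])).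

(** The four vertices of a switch play the same role: these two symmetries
    carry any of them to the first place. *)
Lemma switch_swap_pairs E v b a w : switch E v b a w = switch E a w v b.
Proof. by apply/setP=> e; rewrite !inE (setUC [set v]) (setUC [set b]) andbCA. Qed.

Lemma switch_swap_ends E v b a w : switch E v b a w = switch E b v w a.
Proof.
apply/setP=> e; rewrite !inE (setUC [set v] [set b]) (setUC [set a] [set w]).
by rewrite orbCA.
Qed.

Lemma neighborhood_switch E v b a w : v != b -> v != a -> v != w ->
  neighborhood (switch E v b a w) v = a |: (neighborhood E v :\ b).
Proof.
move=> /negPf vb /negPf va /negPf vw; apply/setP=> y.
by rewrite !inE !eq_set2 eqxx vb va vw /= !orbF.
Qed.

Lemma neighborhood_switch_out E v b a w x :
    x != v -> x != b -> x != a -> x != w ->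
  neighborhood (switch E v b a w) x = neighborhood E x.
Proof.
move=> /negPf xv /negPf xb /negPf xa /negPf xw; apply/setP=> y.
by rewrite !inE !eq_set2 xv xb xa xw.
Qed.

Lemma cards_exchange (T : finType) (S : {set T}) (x y : T) :
  y \in S -> x \notin S -> #|x |: (S :\ y)| = #|S|.
Proof.
move=> yS xS; rewrite cardsU1 !inE (negPf xS) andbF /=.
by rewrite [RHS](cardsD1 y) yS.
Qed.

Lemma deg_switch E v b a w : v != b -> v != a -> v != w ->
  b \in neighborhood E v -> a \notin neighborhood E v ->
  deg (switch E v b a w) v = deg E v.
Proof.
by move=> vb va vw bv av; rewrite /deg neighborhood_switch ?cards_exchange.
Qed.

Lemma simple_graph_switch E v b a w : v != a -> b != w ->
  simple_graph E -> simple_graph (switch E v b a w).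
Proof.
move=> va bw /forall_inP sE; apply/forall_inP=> e; rewrite !inE.
case/or3P=> [/eqP->|/eqP->|/and3P[_ _ /sE //]]; by rewrite cards2 ?va ?bw.
Qed.

Lemma realization_switch (n : nat) (d : V -> 'I_n) E v b a w :
    v != a -> b != w ->
    b \in neighborhood E v -> a \notin neighborhood E v ->
    w \in neighborhood E a -> w \notin neighborhood E b ->
  realization d E -> realization d (switch E v b a w).
Proof.
move=> va bw bv av wa wb /andP[sE /forallP dE].
have neq x y : y \in neighborhood E x -> x != y.
  by apply: contraTneq => <-; apply: notin_neighborhood.
have vb := neq _ _ bv; have aw := neq _ _ wa.
have vw : v != w by apply: contraNneq wb => <-; rewrite neighborhood_sym.
have ab : a != b by apply: contraNneq av => ->.
apply/andP; split; first exact: simple_graph_switch.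
apply/forallP=> x; rewrite -(eqP (dE x)); apply/eqP.
have [->|xv] := eqVneq x v; first exact: deg_switch.
have [->|xb] := eqVneq x b.
  by rewrite switch_swap_ends deg_switch // 1?neighborhood_sym // eq_sym.
have [->|xa] := eqVneq x a.
  by rewrite switch_swap_pairs deg_switch // 1?neighborhood_sym // eq_sym.
have [->|xw] := eqVneq x w; last by rewrite /deg neighborhood_switch_out.
rewrite switch_swap_ends switch_swap_pairs.
by rewrite deg_switch // 1?neighborhood_sym // eq_sym.
Qed.

(** The edge [ab], if present, contributes equally to both degrees; discarding
    it leaves two sets whose cardinalities compare as the degrees do, and [v]
    prevents the neighbors of [a] from all being neighbors of [b]. *)
Lemma exists_private_neighbor E v a b : simple_graph E ->
    deg E b <= deg E a -> v != a ->
    b \in neighborhood E v -> a \notin neighborhood E v ->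
  exists w, [/\ w \in neighborhood E a, w \notin neighborhood E b & b != w].
Proof.
move=> sE dba va bv av.
have card_le : #|neighborhood E b :\ a| <= #|neighborhood E a :\ b|.
  move: dba; rewrite /deg (cardsD1 a) (cardsD1 b (neighborhood E a)).
  by rewrite neighborhood_sym leq_add2l.
have /subsetPn[w] : ~~ (neighborhood E a :\ b \subset neighborhood E b :\ a).
  apply/negP => sub; move: av; rewrite neighborhood_sym => /negP[].
  have /eqP eqN : neighborhood E a :\ b == neighborhood E b :\ a.
    by rewrite eqEcard sub.
  have : v \in neighborhood E b :\ a by rewrite in_setD1 va neighborhood_sym.
  by rewrite -eqN => /setD1P[].
rewrite !in_setD1 => /andP[wb wa]; rewrite negb_and negbK => wNb.
exists w; split; rewrite // 1?eq_sym //.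
have wa' : w != a by apply: contraTneq wa => ->; apply: notin_neighborhood.
by case/orP: wNb => // wEa; rewrite wEa in wa'.
Qed.

End Switching.

Lemma realizable_neighborhoods_exchange (V : finType) (n : nat)
    (d : V -> 'I_n) (v a b : V) (S : {set V}) :
    S \in realizable_neighborhoods d v -> a != v -> d b <= d a ->
    b \in S -> a \notin S ->
  a |: (S :\ b) \in realizable_neighborhoods d v.
Proof.
rewrite inE => /andP[Sv /existsP[E /andP[rE /eqP <-{S Sv}]]] av dba bS aS.
have /andP[sE /forallP dE] := rE; rewrite eq_sym in av.
have [|w [wa wb bw]] := exists_private_neighbor sE _ av bS aS.
  by rewrite (eqP (dE a)) (eqP (dE b)).
have rE' := realization_switch av bw bS aS wa wb rE.
have NE' : neighborhood (switch E v b a w) v = a |: (neighborhood E v :\ b).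
  apply: neighborhood_switch => //.
    by apply: contraTneq bS => <-; apply: notin_neighborhood.
  by apply: contraNneq wb => <-; rewrite neighborhood_sym.
have /andP[sE' _] := rE'.
rewrite inE; apply/andP; split; last first.
  by apply/existsP; exists (switch E v b a w); rewrite rE' NE' /=.
by rewrite -NE' subsetC sub1set inE notin_neighborhood.
Qed.

Section Positions.

Variables (disp : Order.disp_t) (V : finOrderType disp) (n : nat).
Variables (d : V -> 'I_n) (v : V).
Implicit Types (S : {set V}) (i j : 'I_n.-1).

Lemma degree_order_total : total (degree_order d).
Proof.
move=> x y; rewrite /degree_order (eq_sym (d y)).
case: (ltngtP (d x) (d y)) => [||/val_inj->]; rewrite ?orbT //.
by rewrite eqxx; apply: Order.TotalTheory.le_total.
Qed.

Lemma degree_order_trans : transitive (degree_order d).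
Proof.
move=> y x z; rewrite /degree_order.
case/orP=> [yx|/andP[/eqP-> xy]]; case/orP=> [zy|/andP[/eqP<- yz]].
- by rewrite (ltn_trans zy yx).
- by rewrite yx.
- by rewrite zy.
- by rewrite eqxx (Order.POrderTheory.le_trans xy yz) orbT.
Qed.

Lemma ordered_others_uniq : uniq (ordered_others d v).
Proof. by rewrite sort_uniq enum_uniq. Qed.

Lemma mem_ordered_others u : (u \in ordered_others d v) = (u != v).
Proof. by rewrite mem_sort mem_enum !inE. Qed.

Hypothesis cardV : #|V| = n.

Lemma size_ordered_others : size (ordered_others d v) = n.-1.
Proof. by rewrite size_sort -cardE cardsC1 cardV. Qed.

Let vertex i : V := nth v (ordered_others d v) i.

Lemma vertex_inj : injective vertex.
Proof.
move=> i j /eqP; rewrite nth_uniq ?ordered_others_uniq ?size_ordered_others //.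
by move/eqP/val_inj.
Qed.

Lemma vertex_neq i : vertex i != v.
Proof. by rewrite -mem_ordered_others mem_nth ?size_ordered_others. Qed.

Lemma leq_degree_vertex i j : i < j -> d (vertex j) <= d (vertex i).
Proof.
move=> ij.
have: degree_order d (vertex i) (vertex j).
  apply: (sorted_ltn_nth degree_order_trans) ij.
  - exact: (sort_sorted degree_order_total).
  - by rewrite inE size_ordered_others.
  - by rewrite inE size_ordered_others.
by case/orP=> [/ltnW //|/andP[/eqP-> _]].
Qed.

Lemma card_index_set S : S \subset [set~ v] -> #|index_set d v S| = #|S|.
Proof.
move=> /subsetP Sv; rewrite -(card_imset _ vertex_inj).
congr #|pred_of_set _|; apply/setP=> u; apply/imsetP/idP => [[i]|uS].
  by rewrite inE => iS ->.
have uO : u \in ordered_others d v.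
  by rewrite mem_ordered_others; move: (Sv u uS); rewrite !inE.
have ltu : index u (ordered_others d v) < n.-1.
  by rewrite -size_ordered_others index_mem.
by exists (Ordinal ltu); rewrite ?inE /vertex nth_index.
Qed.

Lemma index_set_exchange S i j :
  index_set d v (vertex i |: (S :\ vertex j)) = i |: (index_set d v S :\ j).
Proof. by apply/setP=> k; rewrite !inE !(inj_eq vertex_inj). Qed.

Lemma index_sets_uniform :
  uniform_family (d v)
    [set index_set d v S | S in realizable_neighborhoods d v].
Proof.
move=> _ /imsetP[S + ->].
rewrite inE => /andP[Sv /existsP[E /andP[/andP[_ /forallP dE] /eqP NS]]].
by rewrite card_index_set // -NS; apply/eqP/dE.
Qed.

Lemma index_sets_shifted : graphical d ->
  shifted [set index_set d v S | S in realizable_neighborhoods d v].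
Proof.
move=> [E rE]; split.
  apply/set0Pn; exists (index_set d v (neighborhood E v)); apply: imset_f.
  have /andP[sE _] := rE.
  rewrite inE subsetC sub1set inE notin_neighborhood //=.
  by apply/existsP; exists E; rewrite rE eqxx.
move=> _ i j /imsetP[S SI ->]; rewrite !inE => jS ij iS.
rewrite -index_set_exchange; apply: imset_f.
by apply: realizable_neighborhoods_exchange;
  rewrite ?vertex_neq ?leq_degree_vertex.
Qed.

End Positions.

Theorem theorem5p3 (disp : Order.disp_t) (V : finOrderType disp) (n : nat)
    (cardV : #|V| = n) (d : V -> 'I_n) (hd : graphical d) (v : V) :
  let F : {set {set 'I_n.-1}} :=
    [set index_set d v S | S in realizable_neighborhoods d v] in
  uniform_family (d v) F /\ shifted F.
Proof.
by split; [apply: index_sets_uniform | apply: index_sets_shifted].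
Qed.
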